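(* There is a 1-parameter family of complete, immersed, rotational linear Weingarten surfaces of hyperbolic type in $\mathbb{R}^3$, that is, satisfying a linear Weingarten condition with $\Delta<0$. These surfaces have a translational period.
   Context: For a surface in Euclidean 3-space, let $K$ and $H$ denote its Gauss curvature and mean curvature (half the sum of the principal curvatures). The surface is linear Weingarten if there are real constants $a,b,c$, not all zero, with $aK+2bH+c=0$. The discriminant is $\Delta:=b^2-ac$, and the surface is of hyperbolic type if $\Delta<0$. A rotational surface is a surface of revolution. A surface of revolution has a translational period if it is invariant under a non-trivial translation along its axis of rotation. *)

(* Defs.v *)
From Stdlib Require Import Reals.
From Coquelicot Require Import Coquelicot.
Open Scope R_scope.

(** * Euclidean 3-space *)

Definition R3 : Type := (R * R * R)%type.

Definition mk3 (x y z : R) : R3 := (x, y, z).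
Definition c1 (p : R3) : R := fst (fst p).
Definition c2 (p : R3) : R := snd (fst p).
Definition c3 (p : R3) : R := snd p.

Definition dot (p q : R3) : R := c1 p * c1 q + c2 p * c2 q + c3 p * c3 q.
Definition norm3 (p : R3) : R := sqrt (dot p p).
Definition sub3 (p q : R3) : R3 := mk3 (c1 p - c1 q) (c2 p - c2 q) (c3 p - c3 q).
Definition scal3 (s : R) (p : R3) : R3 := mk3 (s * c1 p) (s * c2 p) (s * c3 p).
Definition cross (p q : R3) : R3 :=
  mk3 (c2 p * c3 q - c3 p * c2 q)
      (c3 p * c1 q - c1 p * c3 q)
      (c1 p * c2 q - c2 p * c1 q).

(** [f] is a similarity transformation of ratio [s]. *)
Definition similarity (s : R) (f : R3 -> R3) : Prop :=
  0 < s /\ forall p q : R3, norm3 (sub3 (f p) (f q)) = s * norm3 (sub3 p q).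

Definition similar (A B : R3 -> Prop) : Prop :=
  exists (s : R) (f : R3 -> R3), similarity s f /\
    forall q : R3, B q <-> exists p : R3, A p /\ f p = q.

(** * Parametrized surfaces

    An immersed surface is given by an immersion of the plane R^2.  For surfaces
    of revolution around the third axis this is the pull-back, along the
    universal covering (u, v) |-> (u, e^{iv}), of an immersed cylinder;
    immersedness, completeness and the curvatures are the same for both. *)

Definition surface : Type := R -> R -> R3.

Definition smooth2 (f : R -> R -> R) : Prop :=
  forall (n : nat) (x y : R), ex_diff_n f n x y.

Definition smooth_surface (X : surface) : Prop :=
  smooth2 (fun u v => c1 (X u v)) /\
  smooth2 (fun u v => c2 (X u v)) /\
  smooth2 (fun u v => c3 (X u v)).

Definition du (X : surface) : surface := fun u v =>
  mk3 (Derive (fun z => c1 (X z v)) u)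
      (Derive (fun z => c2 (X z v)) u)
      (Derive (fun z => c3 (X z v)) u).

Definition dv (X : surface) : surface := fun u v =>
  mk3 (Derive (fun z => c1 (X u z)) v)
      (Derive (fun z => c2 (X u z)) v)
      (Derive (fun z => c3 (X u z)) v).

Definition immersed (X : surface) : Prop :=
  smooth_surface X /\
  forall u v : R, cross (du X u v) (dv X u v) <> mk3 0 0 0.

Definition image (X : surface) (p : R3) : Prop :=
  exists u v : R, p = X u v.

(** First fundamental form E du^2 + 2 F du dv + G dv^2. *)
Definition fE (X : surface) (u v : R) : R := dot (du X u v) (du X u v).
Definition fF (X : surface) (u v : R) : R := dot (du X u v) (dv X u v).
Definition fG (X : surface) (u v : R) : R := dot (dv X u v) (dv X u v).

Definition unit_normal (X : surface) (u v : R) : R3 :=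
  let n := cross (du X u v) (dv X u v) in scal3 (/ norm3 n) n.

(** Second fundamental form L du^2 + 2 M du dv + N dv^2. *)
Definition sL (X : surface) (u v : R) : R :=
  dot (du (du X) u v) (unit_normal X u v).
Definition sM (X : surface) (u v : R) : R :=
  dot (dv (du X) u v) (unit_normal X u v).
Definition sN (X : surface) (u v : R) : R :=
  dot (dv (dv X) u v) (unit_normal X u v).

(** Determinant and half the trace of the shape operator. *)
Definition gauss_curvature (X : surface) (u v : R) : R :=
  (sL X u v * sN X u v - (sM X u v)^2) /
  (fE X u v * fG X u v - (fF X u v)^2).

Definition mean_curvature (X : surface) (u v : R) : R :=
  (fG X u v * sL X u v - 2 * fF X u v * sM X u v + fE X u v * sN X u v) /
  (2 * (fE X u v * fG X u v - (fF X u v)^2)).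

(** The principal curvatures, i.e. the roots k of det (II - k I) = 0, have
    product [gauss_curvature] and half sum [mean_curvature]. *)
Lemma principal_curvatures_eq (X : surface) (u v k : R) :
  fE X u v * fG X u v - (fF X u v)^2 <> 0 ->
  (sL X u v - k * fE X u v) * (sN X u v - k * fG X u v)
    - (sM X u v - k * fF X u v)^2
  = (fE X u v * fG X u v - (fF X u v)^2) *
    (k^2 - 2 * mean_curvature X u v * k + gauss_curvature X u v).
Proof. intros H; unfold mean_curvature, gauss_curvature; field; exact H. Qed.

(** * Completeness of the induced metric *)

Definition C1_curve (c : R -> R * R) : Prop :=
  forall t : R,
    ex_derive (fun s => fst (c s)) t /\
    continuous (Derive (fun s => fst (c s))) t /\
    ex_derive (fun s => snd (c s)) t /\
    continuous (Derive (fun s => snd (c s))) t.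

(** Length of [c], restricted to [0, 1], in the induced metric. *)
Definition curve_length (X : surface) (c : R -> R * R) : R :=
  RInt (fun t =>
    let u := fst (c t) in let v := snd (c t) in
    let u' := Derive (fun s => fst (c s)) t in
    let v' := Derive (fun s => snd (c s)) t in
    sqrt (fE X u v * u'^2 + 2 * fF X u v * u' * v' + fG X u v * v'^2)) 0 1.

(** Admissible curves may have vanishing velocity, so concatenations can be
    reparametrized to be C^1 and piecewise C^1 curves give the same infimum. *)
Definition intrinsic_dist (X : surface) (p q : R * R) : Rbar :=
  Glb_Rbar (fun l => exists c : R -> R * R,
    C1_curve c /\ c 0 = p /\ c 1 = q /\ l = curve_length X c).

Definition complete_surface (X : surface) : Prop :=
  forall p : nat -> R * R,
    (forall eps : R, 0 < eps -> exists N : nat, forall m n : nat,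
       (N <= m)%nat -> (N <= n)%nat ->
       Rbar_lt (intrinsic_dist X (p m) (p n)) eps) ->
    exists q : R * R, forall eps : R, 0 < eps -> exists N : nat, forall n : nat,
      (N <= n)%nat -> Rbar_lt (intrinsic_dist X (p n) q) eps.

(** * Linear Weingarten surfaces *)

Definition satisfies_lW (X : surface) (a b c : R) : Prop :=
  ~ (a = 0 /\ b = 0 /\ c = 0) /\
  forall u v : R,
    a * gauss_curvature X u v + 2 * b * mean_curvature X u v + c = 0.

Definition discriminant (a b c : R) : R := b^2 - a * c.

Definition lW_hyperbolic (X : surface) : Prop :=
  exists a b c : R, satisfies_lW X a b c /\ discriminant a b c < 0.

(** * Surfaces of revolution *)

(** The surface obtained by rotating the profile curve u |-> (r u, 0, h u)
    around the third coordinate axis. *)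
Definition revolution (r h : R -> R) : surface := fun u v =>
  mk3 (r u * cos v) (r u * sin v) (h u).

Definition has_translational_period (X : surface) : Prop :=
  exists T : R, T <> 0 /\
    forall p : R3, image X p <-> image X (mk3 (c1 p) (c2 p) (c3 p + T)).

(* Main.v *)
From Stdlib Require Import Reals Lra Lia Psatz FunctionalExtensionality.
From Coquelicot Require Import Coquelicot.
Require Import Defs.
Open Scope R_scope.

(** Parametrize the profile curve by the angle [u] of its tangent, writing
    [r' = - s cos u] and [h' = - s sin u].  When [s > 0] and [r > 0] the principal
    curvatures of the surface of revolution are [1 / s] and [- sin u / r], and
    the linear Weingarten equation [A K + 2 B H + C = 0] has the first integral

      A (sin u)^2 - 2 B r (sin u) + C r^2 = const.

    In the hyperbolic case this quadratic form is definite, so that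
    [(sin u, r)] moves on an ellipse.  For [B <> 0] and a large enough ellipse,
    an arc over [-1 <= sin u <= 1] has [r > 0] and stays away from the points where
    [s] vanishes; the angle [u] can then run over the whole real line.  The
    profile obtained is a regular curve, with [r] periodic of period [2 PI] and
    [h] periodic up to a vertical translation.

    With [A = 1 + b^2], [B = - b], [C = 1], hence discriminant -1, the ellipse of
    constant 5 gives
    [r = sqrt (5 - (sin u)^2) - b sin u].  Here [r > 0] means [b < 2] and [s > 0] means
    [b > 1/2].  The surfaces with different [b] and the same ellipse constant are
    parallel to each other: [b] only adds a multiple of
    the unit normal [(- sin u, cos u)] of the profile.  Hence [r] and [h] are
    affine functions of [b], whose coefficients depend on [u] alone, and
    their joint smoothness reduces to that of functions of one variable.

    Completeness ([complete_surface_of_bounded_metric]) holds because the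
    induced metric [s^2 du^2 + r^2 dv^2] is uniformly equivalent to the flat
    metric of the parameter plane.  Two surfaces of the family are not similar
    because the distances to the axis fill [[2 - b, 2 + b]], whose endpoints have
    a quotient that determines [b], and because a similarity between periodic
    rotational surfaces must respect the axes ([similar_radial_range]). *)

(** * Smooth functions of one variable and separated functions of two *)

Fixpoint times_derivable (n : nat) (f : R -> R) : Prop :=
  match n with
  | O => True
  | S n => (forall x, ex_derive f x) /\ times_derivable n (Derive f)
  end.

Definition smooth (f : R -> R) : Prop := forall n, times_derivable n f.

(** A derivative known in closed form is usable here, whereas unfolding the
    definition exposes [Derive f]. *)
Lemma times_derivable_S n (f f' : R -> R) :
  (forall x, is_derive f x (f' x)) -> times_derivable n f' ->
  times_derivable (S n) f.
Proof.
intros Hf Hf'; split; [intros x; exists (f' x); apply Hf|].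
replace (Derive f) with f'; [exact Hf'|].
apply functional_extensionality; intros x; symmetry.
now apply is_derive_unique.
Qed.

Lemma times_derivable_pred n (f : R -> R) :
  times_derivable (S n) f -> times_derivable n f.
Proof.
revert f; induction n as [|n IHn]; intros f; [easy|].
intros [Hf Hf']; split; [exact Hf|now apply IHn].
Qed.

Lemma times_derivable_const n (c : R) : times_derivable n (fun _ => c).
Proof.
revert c; induction n as [|n IHn]; intros c; [easy|].
apply (times_derivable_S n _ (fun _ => 0)); [|apply IHn].
intros x; apply (is_derive_const c x).
Qed.

Lemma times_derivable_plus n (f g : R -> R) :
  times_derivable n f -> times_derivable n g ->
  times_derivable n (fun x => f x + g x).
Proof.
revert f g; induction n as [|n IHn]; intros f g; [easy|].
intros [Hf Hf'] [Hg Hg'].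
apply (times_derivable_S n _ (fun x => Derive f x + Derive g x)).
- intros x; apply (is_derive_plus f g x); now apply Derive_correct.
- now apply IHn.
Qed.

Lemma times_derivable_mult n (f g : R -> R) :
  times_derivable n f -> times_derivable n g ->
  times_derivable n (fun x => f x * g x).
Proof.
revert f g; induction n as [|n IHn]; intros f g; [easy|].
intros Hf Hg.
apply (times_derivable_S n _ (fun x => Derive f x * g x + f x * Derive g x)).
- intros x; destruct Hf as [Hf _], Hg as [Hg _].
  apply (is_derive_mult f g x); [now apply Derive_correct..|exact Rmult_comm].
- pose proof (times_derivable_pred n f Hf).
  pose proof (times_derivable_pred n g Hg).
  destruct Hf as [_ Hf], Hg as [_ Hg].
  apply times_derivable_plus; now apply IHn.
Qed.

Lemma smooth_const (c : R) : smooth (fun _ => c).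
Proof. intros n; apply times_derivable_const. Qed.

Lemma smooth_plus (f g : R -> R) :
  smooth f -> smooth g -> smooth (fun x => f x + g x).
Proof. intros Hf Hg n; now apply times_derivable_plus. Qed.

Lemma smooth_mult (f g : R -> R) :
  smooth f -> smooth g -> smooth (fun x => f x * g x).
Proof. intros Hf Hg n; now apply times_derivable_mult. Qed.

Lemma smooth_primitive (f f' : R -> R) :
  (forall x, is_derive f x (f' x)) -> smooth f' -> smooth f.
Proof.
intros Hf Hf' [|n]; [easy|].
now apply (times_derivable_S n f f').
Qed.

Lemma smooth_id : smooth (fun x => x).
Proof.
apply (smooth_primitive _ (fun _ => 1)); [|apply smooth_const].
intros x; apply (is_derive_id x).
Qed.

Lemma smooth_sin_cos : smooth sin /\ smooth cos.
Proof.
assert (H : forall n, times_derivable n sin /\ times_derivable n cos).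
{ induction n as [|n [IHs IHc]]; [easy|]; split.
  - now apply (times_derivable_S n sin cos); [apply is_derive_sin|].
  - apply (times_derivable_S n cos (fun x => -1 * sin x)).
    + intros x; replace (-1 * sin x) with (- sin x) by ring.
      apply is_derive_cos.
    + apply times_derivable_mult; [apply times_derivable_const|exact IHs]. }
split; intros n; apply H.
Qed.

(** The function [w = f^(-1/2)] satisfies [w' = - f' w^3 / 2], so each order
    of differentiability of [w] gives the next one. *)
Lemma smooth_inv_sqrt (f : R -> R) :
  (forall x, 0 < f x) -> smooth f -> smooth (fun x => / sqrt (f x)).
Proof.
intros f_gt0 Hf n.
set (w := fun x => / sqrt (f x)).
induction n as [|n IHn]; [easy|].
apply (times_derivable_S n w
  (fun x => -1/2 * Derive f x * (w x * (w x * w x)))).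
- intros x; unfold w.
  pose proof (f_gt0 x) as fx_gt0.
  pose proof (sqrt_lt_R0 _ fx_gt0) as sx_gt0.
  assert (Dfx : ex_derive f x) by now destruct (Hf 1%nat).
  auto_derive; [repeat split; trivial; lra|].
  change (fun x => f x) with f; field; lra.
- apply times_derivable_mult; [|now repeat apply times_derivable_mult].
  apply times_derivable_mult;
    [apply times_derivable_const|exact (proj2 (Hf (S n)))].
Qed.

(** The partial derivatives of a separated function are separated functions of
    the derivatives of the factors. *)
Lemma smooth2_separated (f g : R -> R) :
  smooth f -> smooth g -> smooth2 (fun x y => f x * g y).
Proof.
intros Hf Hg n x y; specialize (Hf (S n)); specialize (Hg (S n)).
revert f g Hf Hg x y.
induction n as [|n IHn]; intros f g Hf Hg x y.
all: assert (Cfg : continuity_2d_pt (fun x y => f x * g y) x y) by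
  (destruct Hf as [Hf _], Hg as [Hg _];
   apply continuity_2d_pt_mult; apply continuity_1d_2d_pt_comp;
   [apply derivable_continuous_pt, ex_derive_Reals_0, Hf
   |apply continuity_2d_pt_id1
   |apply derivable_continuous_pt, ex_derive_Reals_0, Hg
   |apply continuity_2d_pt_id2]).
- now split.
- destruct (Hf) as [Df Hf']; destruct (Hg) as [Dg Hg'].
  split; [exact Cfg|]; repeat split.
  + apply (ex_derive_scal_l f x (g y)), Df.
  + apply (ex_derive_scal g (f x) y), Dg.
  + replace (fun u v => Derive (fun z => f z * g v) u)
      with (fun u v => Derive f u * g v).
    * apply IHn; [exact Hf'|now apply times_derivable_pred].
    * apply functional_extensionality; intros u.
      apply functional_extensionality; intros v.
      now rewrite Derive_scal_l.
  + replace (fun u v => Derive (fun z => f u * g z) v)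
      with (fun u v => f u * Derive g v).
    * apply IHn; [now apply times_derivable_pred|exact Hg'].
    * apply functional_extensionality; intros u.
      apply functional_extensionality; intros v.
      now rewrite Derive_scal.
Qed.

Lemma smooth2_plus (f g : R -> R -> R) :
  smooth2 f -> smooth2 g -> smooth2 (fun x y => f x y + g x y).
Proof.
intros Hf Hg n; specialize (Hf n); specialize (Hg n).
revert f g Hf Hg; induction n as [|n IHn]; intros f g Hf Hg x y.
- split; [apply continuity_2d_pt_plus; [apply Hf|apply Hg]|easy].
- split; [apply continuity_2d_pt_plus; [apply Hf|apply Hg]|].
  assert (Df1 : forall x y, ex_derive (fun z => f z y) x) by apply Hf.
  assert (Df2 : forall x y, ex_derive (fun z => f x z) y) by apply Hf.
  assert (Dg1 : forall x y, ex_derive (fun z => g z y) x) by apply Hg.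
  assert (Dg2 : forall x y, ex_derive (fun z => g x z) y) by apply Hg.
  split; [|split; [|split]].
  + exact (ex_derive_plus (V := R_NormedModule) _ _ x (Df1 x y) (Dg1 x y)).
  + exact (ex_derive_plus (V := R_NormedModule) _ _ y (Df2 x y) (Dg2 x y)).
  + replace (fun u v => Derive (fun z => f z v + g z v) u)
      with (fun u v => Derive (fun z => f z v) u + Derive (fun z => g z v) u).
    * apply IHn; intros u v; [apply Hf|apply Hg].
    * apply functional_extensionality; intros u.
      apply functional_extensionality; intros v.
      now rewrite Derive_plus.
  + replace (fun u v => Derive (fun z => f u z + g u z) v)
      with (fun u v => Derive (fun z => f u z) v + Derive (fun z => g u z) v).
    * apply IHn; intros u v; [apply Hf|apply Hg].
    * apply functional_extensionality; intros u.
      apply functional_extensionality; intros v.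
      now rewrite Derive_plus.
Qed.

(** * Curvatures of a surface of revolution *)

Lemma smooth_revolution (r h : R -> R) :
  smooth r -> smooth h -> smooth_surface (revolution r h).
Proof.
intros Hr Hh; destruct smooth_sin_cos as [Hs Hc].
split; [|split]; cbn.
- now apply (smooth2_separated r cos).
- now apply (smooth2_separated r sin).
- replace (fun u _ => h u) with (fun u v : R => h u * (fun _ => 1) v).
  + apply (smooth2_separated h (fun _ => 1)); [exact Hh|apply smooth_const].
  + apply functional_extensionality; intros u.
    apply functional_extensionality; intros v; ring.
Qed.

Section Revolution.

(** The profile is parametrized by its tangent angle, so that [sigma] is both
    its speed and its radius of curvature; the minus signs make [sigma]
    positive for the profiles used below. *)
Variables r h sigma dsigma : R -> R.
Hypothesis r_gt0 : forall u, 0 < r u.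
Hypothesis sigma_gt0 : forall u, 0 < sigma u.
Hypothesis dr : forall u, is_derive r u (- sigma u * cos u).
Hypothesis dh : forall u, is_derive h u (- sigma u * sin u).
Hypothesis ds : forall u, is_derive sigma u (dsigma u).

Let X := revolution r h.

Lemma du_revolution (u v : R) :
  du X u v =
  mk3 (- sigma u * cos u * cos v) (- sigma u * cos u * sin v) (- sigma u * sin u).
Proof.
unfold du, X, revolution; cbn.
rewrite !Derive_scal_l; change (fun z => h z) with h.
now rewrite (is_derive_unique _ _ _ (dr u)), (is_derive_unique _ _ _ (dh u)).
Qed.

Lemma dv_revolution (u v : R) :
  dv X u v = mk3 (- r u * sin v) (r u * cos v) 0.
Proof.
unfold dv, X, revolution; cbn.
rewrite !Derive_scal, Derive_const.
rewrite (is_derive_unique _ _ _ (is_derive_cos v)).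
rewrite (is_derive_unique _ _ _ (is_derive_sin v)).
apply f_equal3; ring.
Qed.

Lemma fE_revolution (u v : R) : fE X u v = sigma u ^ 2.
Proof.
unfold fE; rewrite du_revolution; unfold dot; cbn.
pose proof (sin2_cos2 u) as Hu; pose proof (sin2_cos2 v) as Hv.
unfold Rsqr in Hu, Hv.
transitivity (sigma u ^ 2 * ((sin u * sin u)
   + cos u * cos u * (sin v * sin v + cos v * cos v))); [ring|].
rewrite Hv, Rmult_1_r, Hu; ring.
Qed.

Lemma fF_revolution (u v : R) : fF X u v = 0.
Proof.
unfold fF; rewrite du_revolution, dv_revolution; unfold dot; cbn; ring.
Qed.

Lemma fG_revolution (u v : R) : fG X u v = r u ^ 2.
Proof.
unfold fG; rewrite dv_revolution; unfold dot; cbn.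
pose proof (sin2_cos2 v) as Hv; unfold Rsqr in Hv.
transitivity (r u ^ 2 * (sin v * sin v + cos v * cos v)); [ring|].
rewrite Hv; ring.
Qed.

Lemma normal_revolution (u v : R) :
  cross (du X u v) (dv X u v) =
  scal3 (r u * sigma u) (mk3 (sin u * cos v) (sin u * sin v) (- cos u)).
Proof.
rewrite du_revolution, dv_revolution.
pose proof (sin2_cos2 v) as Hv; unfold Rsqr in Hv.
unfold cross, scal3; cbn; apply f_equal3; try ring.
transitivity (- r u * sigma u * cos u * (sin v * sin v + cos v * cos v)); [ring|].
rewrite Hv; ring.
Qed.

Lemma norm3_normal_revolution (u v : R) :
  norm3 (cross (du X u v) (dv X u v)) = r u * sigma u.
Proof.
rewrite normal_revolution; unfold norm3, dot, scal3, mk3; cbn.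
pose proof (sin2_cos2 u) as Hu; pose proof (sin2_cos2 v) as Hv.
unfold Rsqr in Hu, Hv.
transitivity (sqrt (Rsqr (r u * sigma u)));
  [|now apply sqrt_Rsqr, Rlt_le, Rmult_lt_0_compat].
f_equal; unfold Rsqr.
transitivity (r u * sigma u * (r u * sigma u) * (cos u * cos u
   + sin u * sin u * (sin v * sin v + cos v * cos v))); [ring|].
rewrite Hv, Rmult_1_r, (Rplus_comm (cos u * cos u)), Hu; ring.
Qed.

Lemma unit_normal_revolution (u v : R) :
  unit_normal X u v = mk3 (sin u * cos v) (sin u * sin v) (- cos u).
Proof.
unfold unit_normal; rewrite norm3_normal_revolution, normal_revolution.
pose proof (r_gt0 u); pose proof (sigma_gt0 u).
unfold scal3; cbn; apply f_equal3; field; lra.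
Qed.

Lemma immersed_revolution : smooth r -> smooth h -> immersed X.
Proof.
intros Hr Hh; split; [now apply smooth_revolution|].
intros u v E; pose proof (norm3_normal_revolution u v) as H.
rewrite E in H; unfold norm3, dot, mk3 in H; cbn in H.
replace (0 * 0 + 0 * 0 + 0 * 0) with 0 in H by ring.
rewrite sqrt_0 in H.
pose proof (Rmult_lt_0_compat _ _ (r_gt0 u) (sigma_gt0 u)); lra.
Qed.

(** The derivative of [sigma] enters the second derivative of the profile along
    the tangent only, and drops out of the normal component. *)
Lemma sL_revolution (u v : R) : sL X u v = sigma u.
Proof.
unfold sL; rewrite unit_normal_revolution.
unfold du at 1.
rewrite (Derive_ext _ (fun z => - sigma z * cos z * cos v))
  by (intros z; now rewrite du_revolution).
rewrite (Derive_ext (fun z => c2 _) (fun z => - sigma z * cos z * sin v))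
  by (intros z; now rewrite du_revolution).
rewrite (Derive_ext (fun z => c3 _) (fun z => - sigma z * sin z))
  by (intros z; now rewrite du_revolution).
assert (D1 : Derive (fun z => - sigma z * cos z) u
   = - dsigma u * cos u + sigma u * sin u).
{ apply is_derive_unique; specialize (ds u); pose proof (is_derive_unique _ _ _ ds) as E.
  auto_derive; [now exists (dsigma u)|].
  change (fun x => sigma x) with sigma; rewrite E; ring. }
assert (D2 : Derive (fun z => - sigma z * sin z) u
   = - dsigma u * sin u - sigma u * cos u).
{ apply is_derive_unique; specialize (ds u); pose proof (is_derive_unique _ _ _ ds) as E.
  auto_derive; [now exists (dsigma u)|].
  change (fun x => sigma x) with sigma; rewrite E; ring. }
rewrite !Derive_scal_l.
rewrite D1, D2.
unfold dot; cbn.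
pose proof (sin2_cos2 u) as Hu; pose proof (sin2_cos2 v) as Hv.
unfold Rsqr in Hu, Hv.
transitivity ((- dsigma u * cos u + sigma u * sin u) * sin u
   * (sin v * sin v + cos v * cos v)
   + (dsigma u * sin u + sigma u * cos u) * cos u); [ring|].
rewrite Hv.
transitivity (sigma u * (sin u * sin u + cos u * cos u)); [ring|].
rewrite Hu; ring.
Qed.

Lemma sM_revolution (u v : R) : sM X u v = 0.
Proof.
unfold sM; rewrite unit_normal_revolution.
unfold dv at 1.
rewrite (Derive_ext _ (fun z => - sigma u * cos u * cos z))
  by (intros z; now rewrite du_revolution).
rewrite (Derive_ext (fun z => c2 _) (fun z => - sigma u * cos u * sin z))
  by (intros z; now rewrite du_revolution).
rewrite (Derive_ext (fun z => c3 _) (fun _ => - sigma u * sin u))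
  by (intros z; now rewrite du_revolution).
rewrite !Derive_scal, Derive_const.
rewrite (is_derive_unique _ _ _ (is_derive_cos v)).
rewrite (is_derive_unique _ _ _ (is_derive_sin v)).
unfold dot; cbn; ring.
Qed.

Lemma sN_revolution (u v : R) : sN X u v = - r u * sin u.
Proof.
unfold sN; rewrite unit_normal_revolution.
unfold dv at 1.
rewrite (Derive_ext _ (fun z => - r u * sin z))
  by (intros z; now rewrite dv_revolution).
rewrite (Derive_ext (fun z => c2 _) (fun z => r u * cos z))
  by (intros z; now rewrite dv_revolution).
rewrite (Derive_ext (fun z => c3 _) (fun _ => 0))
  by (intros z; now rewrite dv_revolution).
rewrite !Derive_scal, Derive_const.
rewrite (is_derive_unique _ _ _ (is_derive_cos v)).
rewrite (is_derive_unique _ _ _ (is_derive_sin v)).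
pose proof (sin2_cos2 v) as Hv; unfold Rsqr in Hv.
unfold dot; cbn.
transitivity (- r u * sin u * (sin v * sin v + cos v * cos v)); [ring|].
rewrite Hv; ring.
Qed.

(** The principal curvatures are [1 / sigma u] and [- sin u / r u], so the
    hypothesis is the linear Weingarten equation cleared of denominators. *)
Lemma satisfies_lW_revolution (a b c : R) :
  ~ (a = 0 /\ b = 0 /\ c = 0) ->
  (forall u, - a * sin u + b * (r u - sigma u * sin u) + c * (r u * sigma u) = 0) ->
  satisfies_lW X a b c.
Proof.
intros abc_neq0 Hu; split; [exact abc_neq0|]; intros u v; specialize (Hu u).
unfold gauss_curvature, mean_curvature.
rewrite fE_revolution, fF_revolution, fG_revolution,
  sL_revolution, sM_revolution, sN_revolution.
pose proof (r_gt0 u); pose proof (sigma_gt0 u).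
transitivity ((- a * sin u + b * (r u - sigma u * sin u) + c * (r u * sigma u))
   / (r u * sigma u)); [field; lra|].
rewrite Hu; field; lra.
Qed.

End Revolution.

(** * Completeness *)

Definition metric_form (X : surface) (u v a b : R) : R :=
  fE X u v * a ^ 2 + 2 * fF X u v * a * b + fG X u v * b ^ 2.

Section Completeness.

Variables (X : surface) (e M : R).
Hypothesis e_gt0 : 0 < e.
Hypothesis M_gt0 : 0 < M.
Hypothesis contE : forall u v, continuity_2d_pt (fE X) u v.
Hypothesis contF : forall u v, continuity_2d_pt (fF X) u v.
Hypothesis contG : forall u v, continuity_2d_pt (fG X) u v.
Hypothesis metric_ge : forall u v a b,
  e ^ 2 * (a ^ 2 + b ^ 2) <= metric_form X u v a b.
Hypothesis metric_le : forall u v a b,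
  metric_form X u v a b <= M ^ 2 * (a ^ 2 + b ^ 2).

Let curve_speed (c : R -> R * R) (t : R) : R :=
  sqrt (metric_form X (fst (c t)) (snd (c t))
    (Derive (fun s => fst (c s)) t) (Derive (fun s => snd (c s)) t)).

Lemma continuous_curve_speed (c : R -> R * R) (t : R) :
  C1_curve c -> continuous (curve_speed c) t.
Proof.
intros Hc; destruct (Hc t) as (D1 & C1 & D2 & C2).
apply (continuous_comp _ sqrt); [|apply continuous_sqrt].
assert (K : forall f : R -> R -> R, (forall u v, continuity_2d_pt f u v) ->
  continuous (fun t => f (fst (c t)) (snd (c t))) t).
{ intros f Cf.
  apply (continuous_comp_2 (fun t => fst (c t)) (fun t => snd (c t)) f).
  - now apply (ex_derive_continuous (fun t => fst (c t))).
  - now apply (ex_derive_continuous (fun t => snd (c t))).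
  - now apply continuity_2d_pt_filterlim. }
assert (P : forall f g : R -> R,
  continuous f t -> continuous g t -> continuous (fun t => f t + g t) t).
{ intros f g; apply (continuous_plus (V := R_NormedModule) f g). }
assert (T : forall f g : R -> R,
  continuous f t -> continuous g t -> continuous (fun t => f t * g t) t).
{ intros f g; apply (continuous_mult (K := R_AbsRing) f g). }
assert (S : forall f : R -> R, continuous f t -> continuous (fun t => f t ^ 2) t).
{ intros f Hf; apply (T f (fun t => f t * 1)); [exact Hf|].
  apply (T f (fun _ => 1)); [exact Hf|apply continuous_const]. }
unfold metric_form; apply P; [apply P|].
- apply T; [now apply K|now apply S].
- apply T; [apply T; [apply T; [apply continuous_const|now apply K]|]|]; trivial.
- apply T; [now apply K|now apply S].
Qed.

Lemma is_RInt_curve_speed (c : R -> R * R) :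
  C1_curve c -> is_RInt (curve_speed c) 0 1 (curve_length X c).
Proof.
intros Hc; apply (RInt_correct (V := R_CompleteNormedModule)).
apply (ex_RInt_continuous (V := R_CompleteNormedModule)); intros t _.
now apply continuous_curve_speed.
Qed.

(** [x] stands for either of the two coordinates of [c]. *)
Lemma displacement_le_curve_length (c : R -> R * R) (x : R -> R) :
  C1_curve c ->
  (forall t, ex_derive x t) -> (forall t, continuous (Derive x) t) ->
  (forall t, e * Rabs (Derive x t) <= curve_speed c t) ->
  e * Rabs (x 1 - x 0) <= curve_length X c.
Proof.
intros Hc Dx Cx Hx.
assert (I : is_RInt (Derive x) 0 1 (x 1 - x 0))
  by (apply (is_RInt_derive x); intros t _; [now apply Derive_correct|apply Cx]).
assert (J := is_RInt_scal _ _ _ (/ e) _ (is_RInt_curve_speed c Hc)).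
assert (H : Rabs (x 1 - x 0) <= / e * curve_length X c).
{ refine (norm_RInt_le (V := R_NormedModule) _ _ 0 1 _ _ Rle_0_1 _ I J).
  intros t _; specialize (Hx t).
  apply (Rmult_le_reg_l e _ _ e_gt0).
  unfold scal; cbn; unfold mult; cbn; unfold norm; cbn; unfold abs; cbn.
  rewrite <- Rmult_assoc, Rinv_r, Rmult_1_l; [exact Hx|lra]. }
apply (Rmult_le_reg_l (/ e)); [now apply Rinv_0_lt_compat|].
rewrite <- Rmult_assoc, Rinv_l, Rmult_1_l; [exact H|lra].
Qed.

Lemma le_intrinsic_dist (p q : R * R) :
  Rbar_le (e * Rabs (fst q - fst p)) (intrinsic_dist X p q) /\
  Rbar_le (e * Rabs (snd q - snd p)) (intrinsic_dist X p q).
Proof.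
assert (K : forall u v a b, e * Rabs a <= sqrt (metric_form X u v a b) /\
                            e * Rabs b <= sqrt (metric_form X u v a b)).
{ intros u v a b; specialize (metric_ge u v a b).
  split; (rewrite <- (Rabs_pos_eq e) at 1 by lra); rewrite <- Rabs_mult,
    <- sqrt_Rsqr_abs; apply sqrt_le_1_alt; unfold Rsqr; nra. }
split; apply (proj2 (Glb_Rbar_correct _)); intros l (c & Hc & <- & <- & ->).
- apply (displacement_le_curve_length c (fun t => fst (c t)) Hc).
  1,2: intros t; apply (Hc t).
  intros t; apply K.
- apply (displacement_le_curve_length c (fun t => snd (c t)) Hc).
  1,2: intros t; apply (Hc t).
  intros t; apply K.
Qed.

(** The bound is one for the length of the straight segment from [p] to [q]. *)
Lemma intrinsic_dist_le (p q : R * R) :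
  Rbar_le (intrinsic_dist X p q)
    (M * (Rabs (fst q - fst p) + Rabs (snd q - snd p))).
Proof.
set (a := fst q - fst p); set (b := snd q - snd p).
set (c := fun t : R => (fst p + t * a, snd p + t * b)).
assert (D : forall x d t, Derive (fun s => x + s * d) t = d).
{ intros x d t; apply is_derive_unique; auto_derive; [easy|ring]. }
assert (Hc : C1_curve c).
{ intros t; unfold c; cbn.
  split; [now auto_derive|split; [|split; [now auto_derive|]]].
  - apply (continuous_ext (fun _ => a)); [intros s; now rewrite D|].
    apply continuous_const.
  - apply (continuous_ext (fun _ => b)); [intros s; now rewrite D|].
    apply continuous_const. }
apply Rbar_le_trans with (curve_length X c).
- apply (proj1 (Glb_Rbar_correct _)); exists c; split; [exact Hc|split; [|split; [|easy]]].
  + unfold c; rewrite (surjective_pairing p) at 3; f_equal; ring.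
  + unfold c, a, b; rewrite (surjective_pairing q) at 3.
    f_equal; ring.
- apply Rle_trans with (RInt (fun _ => M * (Rabs a + Rabs b)) 0 1).
  + apply RInt_le; [apply Rle_0_1|exists (curve_length X c); now apply is_RInt_curve_speed
                   |apply ex_RInt_const|].
    intros t _; cbn -[pow]; rewrite !D.
    specialize (metric_le (fst p + t * a) (snd p + t * b) a b).
    rewrite <- (sqrt_Rsqr (M * _)).
    * apply sqrt_le_1_alt; eapply Rle_trans; [exact metric_le|].
      unfold Rsqr; rewrite <- (pow2_abs a), <- (pow2_abs b).
      pose proof (Rabs_pos a); pose proof (Rabs_pos b).
      assert (0 <= Rabs a * Rabs b) by nra; assert (0 < M ^ 2) by nra.
      nra.
    * apply Rmult_le_pos; [lra|].
      pose proof (Rabs_pos a); pose proof (Rabs_pos b); lra.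
  + rewrite RInt_const; unfold scal; cbn; unfold mult; cbn; lra.
Qed.

(** The intrinsic distance is comparable to the distance of the parameters, so
    completeness is inherited from [R * R]. *)
Lemma complete_surface_of_bounded_metric : complete_surface X.
Proof.
intros p Cp.
assert (K : forall f : R * R -> R,
  (forall p q, Rbar_le (e * Rabs (f q - f p)) (intrinsic_dist X p q)) ->
  { l | Un_cv (fun n => f (p n)) l }).
{ intros f Hf; apply Rcomplete.R_complete; intros eps eps_gt0.
  destruct (Cp (e * eps)) as [N HN]; [now apply Rmult_lt_0_compat|].
  exists N; intros n m Hn Hm.
  apply (Rmult_lt_reg_l e _ _ e_gt0).
  apply (Rbar_le_lt_trans _ _ _ (Hf (p m) (p n)) (HN m n Hm Hn)). }
destruct (K fst) as [x Hx]; [intros; apply le_intrinsic_dist|].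
destruct (K snd) as [y Hy]; [intros; apply le_intrinsic_dist|].
exists (x, y); intros eps eps_gt0.
destruct (Hx (eps / (2 * M))) as [N1 HN1]; [apply Rdiv_lt_0_compat; lra|].
destruct (Hy (eps / (2 * M))) as [N2 HN2]; [apply Rdiv_lt_0_compat; lra|].
exists (N1 + N2)%nat; intros n Hn.
apply (Rbar_le_lt_trans _ _ _ (intrinsic_dist_le _ _)); cbn.
specialize (HN1 n ltac:(lia)); specialize (HN2 n ltac:(lia)).
unfold Rdist in HN1, HN2; rewrite Rabs_minus_sym in HN1, HN2.
apply Rlt_le_trans with (M * (eps / (2 * M) + eps / (2 * M))).
- apply Rmult_lt_compat_l; lra.
- apply Req_le; field; lra.
Qed.

End Completeness.

(** * Similar sets around an axis *)

Definition axial_dist2 (p : R3) : R := c1 p ^ 2 + c2 p ^ 2.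

Definition half_turn (p : R3) : R3 := mk3 (- c1 p) (- c2 p) (c3 p).

Definition radial_range (A : R3 -> Prop) (m M : R) : Prop :=
  (forall p, A p -> m ^ 2 <= axial_dist2 p <= M ^ 2) /\
  (exists p, A p /\ axial_dist2 p = m ^ 2) /\
  (exists p, A p /\ axial_dist2 p = M ^ 2).

Definition half_turn_invariant (A : R3 -> Prop) : Prop :=
  forall p, A p -> A (half_turn p).

Definition vertically_periodic (A : R3 -> Prop) : Prop :=
  exists T, T <> 0 /\ forall p, A p -> A (mk3 (c1 p) (c2 p) (c3 p + T)).

Lemma bounded_line_is_constant (x y C : R) :
  (forall n : nat, (x + INR n * y) ^ 2 <= C) -> y = 0.
Proof.
intros H.
destruct (Req_dec y 0) as [|y_neq0]; [easy|exfalso].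
assert (y2_gt0 : 0 < y ^ 2) by now apply pow2_gt_0.
pose proof (H 0%nat) as H0; cbn [INR] in H0.
(* For [n y^2 > 2 C + 2 x^2 + 1] the bound on [x + n y] fails. *)
destruct (INR_unbounded ((2 * C + 2 * x ^ 2 + 1) / y ^ 2)) as [n Hn].
specialize (H n).
assert (n_ge1 : 1 <= INR n).
{ destruct n as [|n]; [|rewrite S_INR; pose proof (pos_INR n); lra].
  exfalso; cbn in Hn.
  assert (0 < (2 * C + 2 * x ^ 2 + 1) / y ^ 2)
    by (apply Rdiv_lt_0_compat; nra).
  cbn in *; lra. }
assert (K : 2 * C + 2 * x ^ 2 + 1 < INR n * y ^ 2).
{ apply (Rmult_lt_compat_r (y ^ 2)) in Hn; [|easy].
  unfold Rdiv in Hn; rewrite Rmult_assoc, Rinv_l, Rmult_1_r in Hn; lra. }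
assert (INR n * y ^ 2 <= (INR n * y) ^ 2).
{ replace ((INR n * y) ^ 2) with (INR n * (INR n * y ^ 2)) by ring.
  rewrite <- (Rmult_1_l (INR n * y ^ 2)) at 1.
  apply Rmult_le_compat_r; nra. }
assert (0 <= (2 * x + INR n * y) ^ 2) by apply pow2_ge_0.
nra.
Qed.

Section Similarity.

Variables (s : R) (f : R3 -> R3).
Hypothesis f_sim : similarity s f.

Let g (p : R3) : R3 := sub3 (f p) (f (mk3 0 0 0)).

(** Polarization of the equation between squared distances. *)
Lemma dot_similarity (p q : R3) : dot (g p) (g q) = s ^ 2 * dot p q.
Proof.
assert (K : forall p q, dot (sub3 (f p) (f q)) (sub3 (f p) (f q))
                        = s ^ 2 * dot (sub3 p q) (sub3 p q)).
{ intros p' q'; destruct f_sim as [s_gt0 Hf].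
  specialize (Hf p' q'); apply (f_equal (fun x => x ^ 2)) in Hf.
  unfold norm3 in Hf; rewrite Rpow_mult_distr, !pow2_sqrt in Hf; [exact Hf|..];
  unfold dot; nra. }
pose proof (K p q) as H1.
pose proof (K p (mk3 0 0 0)) as H2; pose proof (K q (mk3 0 0 0)) as H3.
unfold g; revert H1 H2 H3; unfold dot, sub3, mk3; cbn -[pow].
generalize (f (0, 0, 0)); intros o H1 H2 H3; nra.
Qed.

Lemma dot_sub3_eq0 (p q : R3) : dot (sub3 p q) (sub3 p q) = 0 -> p = q.
Proof.
destruct p as [[p1 p2] p3], q as [[q1 q2] q3].
unfold dot; cbn; intros H.
pose proof (Rle_0_sqr (p1 - q1)) as H1; pose proof (Rle_0_sqr (p2 - q2)) as H2.
pose proof (Rle_0_sqr (p3 - q3)) as H3; unfold Rsqr in H1, H2, H3.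
apply (f_equal3 mk3); apply Rminus_diag_uniq, Rsqr_0_uniq; unfold Rsqr; lra.
Qed.

(** A map preserving scalar products up to a factor is linear: the squared norm
    of the defect of linearity expands into scalar products of values, and
    these sum to a multiple of the squared norm of the zero vector. *)
Lemma similarity_vertical (x y z t : R) :
  g (mk3 x y (z + t)) =
  mk3 (c1 (g (mk3 x y z)) + t * c1 (g (mk3 0 0 1)))
      (c2 (g (mk3 x y z)) + t * c2 (g (mk3 0 0 1)))
      (c3 (g (mk3 x y z)) + t * c3 (g (mk3 0 0 1))).
Proof.
set (p := mk3 x y z); set (q := mk3 x y (z + t)); set (e := mk3 0 0 1).
assert (Z : g q = sub3 (g p) (scal3 (- t) (g e))).
{ apply dot_sub3_eq0.
  transitivity (dot (g q) (g q) + dot (g p) (g p) + t ^ 2 * dot (g e) (g e)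
    - 2 * dot (g q) (g p) - 2 * t * dot (g q) (g e) + 2 * t * dot (g p) (g e));
    [unfold dot, sub3, scal3, mk3; cbn; ring|].
  rewrite !dot_similarity; unfold dot, p, q, e, mk3; cbn; ring. }
rewrite Z; apply f_equal3; cbn -[g]; ring.
Qed.

Lemma similarity_opp (x y : R) :
  g (mk3 (- x) (- y) 0) = scal3 (-1) (g (mk3 x y 0)).
Proof.
set (p := mk3 x y 0); set (q := mk3 (- x) (- y) 0).
apply dot_sub3_eq0.
transitivity (dot (g q) (g q) + dot (g p) (g p) + 2 * dot (g q) (g p));
  [unfold dot, sub3, scal3, mk3; cbn; ring|].
rewrite !dot_similarity; unfold dot, p, q, mk3; cbn; ring.
Qed.

(** When the image of the axis is vertical, horizontal vectors, being
    orthogonal to the axis, have horizontal images. *)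
Lemma similarity_horizontal (p : R3) :
  c1 (g (mk3 0 0 1)) = 0 -> c2 (g (mk3 0 0 1)) = 0 ->
  axial_dist2 (g p) = s ^ 2 * axial_dist2 p /\
  c1 (g (half_turn p)) = - c1 (g p) /\ c2 (g (half_turn p)) = - c2 (g p).
Proof.
intros W1 W2; destruct p as [[x y] z].
assert (H := similarity_vertical x y 0 z).
assert (H' := similarity_vertical (- x) (- y) 0 z).
rewrite Rplus_0_l, W1, W2 in H, H'; rewrite similarity_opp in H'.
unfold half_turn; cbn -[g].
assert (V := dot_similarity (mk3 x y 0) (mk3 0 0 1)).
assert (N := dot_similarity (mk3 x y 0) (mk3 x y 0)).
assert (U := dot_similarity (mk3 0 0 1) (mk3 0 0 1)).
change (x, y, z) with (mk3 x y z).
rewrite H, H'.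
unfold dot in V, N, U; rewrite W1, W2 in V, U.
unfold axial_dist2; cbn -[g pow] in *.
assert (s_gt0 : 0 < s) by apply f_sim.
assert (U' : c3 (g (mk3 0 0 1)) <> 0) by (intros E; rewrite E in U; nra).
assert (V' : c3 (g (mk3 x y 0)) = 0).
{ apply (Rmult_eq_reg_r (c3 (g (mk3 0 0 1)))); [lra|exact U']. }
rewrite V' in N; repeat split; nra.
Qed.

End Similarity.

(** Translating a point of [A] by multiples of the period gives points on a
    vertical line.  Its image would leave every cylinder around the axis, and so
    [B], if it were not vertical. *)
Lemma similarity_axis_vertical (s : R) (f : R3 -> R3) (A B : R3 -> Prop) (m M : R) :
  similarity s f -> (forall p, A p -> B (f p)) ->
  (exists p, A p) -> vertically_periodic A ->
  radial_range B m M ->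
  c1 (f (mk3 0 0 1)) = c1 (f (mk3 0 0 0)) /\
  c2 (f (mk3 0 0 1)) = c2 (f (mk3 0 0 0)).
Proof.
intros Hf AB [[[x y] z] Ap] (T & T_neq0 & AT) [HB _].
assert (An : forall n : nat, A (mk3 x y (z + INR n * T))).
{ induction n as [|n IHn].
  - now cbn [INR]; rewrite Rmult_0_l, Rplus_0_r.
  - apply AT in IHn; cbn [c1 c2 c3 mk3 fst snd] in IHn.
    replace (z + INR (S n) * T) with (z + INR n * T + T)
      by (rewrite S_INR; ring); exact IHn. }
assert (K : forall n : nat,
  (c1 (f (mk3 x y z)) + INR n * (T * (c1 (f (mk3 0 0 1)) - c1 (f (mk3 0 0 0))))) ^ 2
   <= M ^ 2 /\
  (c2 (f (mk3 x y z)) + INR n * (T * (c2 (f (mk3 0 0 1)) - c2 (f (mk3 0 0 0))))) ^ 2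
   <= M ^ 2).
{ intros n; destruct (HB _ (AB _ (An n))) as [_ H]; revert H.
  assert (E := similarity_vertical s f Hf x y z (INR n * T)).
  assert (E1 : c1 (f (mk3 x y (z + INR n * T))) - c1 (f (mk3 0 0 0)) =
    (c1 (f (mk3 x y z)) - c1 (f (mk3 0 0 0)))
    + INR n * T * (c1 (f (mk3 0 0 1)) - c1 (f (mk3 0 0 0))))
    by exact (f_equal c1 E).
  assert (E2 : c2 (f (mk3 x y (z + INR n * T))) - c2 (f (mk3 0 0 0)) =
    (c2 (f (mk3 x y z)) - c2 (f (mk3 0 0 0)))
    + INR n * T * (c2 (f (mk3 0 0 1)) - c2 (f (mk3 0 0 0))))
    by exact (f_equal c2 E).
  unfold axial_dist2; rewrite <- !Rmult_assoc.
  replace (c1 (f (mk3 x y (z + INR n * T)))) with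
    (c1 (f (mk3 x y z)) + INR n * T * (c1 (f (mk3 0 0 1)) - c1 (f (mk3 0 0 0))))
    by lra.
  replace (c2 (f (mk3 x y (z + INR n * T)))) with
    (c2 (f (mk3 x y z)) + INR n * T * (c2 (f (mk3 0 0 1)) - c2 (f (mk3 0 0 0))))
    by lra.
  intros H; split; (eapply Rle_trans; [|exact H]);
    pose proof (pow2_ge_0 (c1 (f (mk3 x y z))
      + INR n * T * (c1 (f (mk3 0 0 1)) - c1 (f (mk3 0 0 0)))));
    pose proof (pow2_ge_0 (c2 (f (mk3 x y z))
      + INR n * T * (c2 (f (mk3 0 0 1)) - c2 (f (mk3 0 0 0)))));
    lra. }
split.
- apply Rminus_diag_uniq.
  apply (Rmult_eq_reg_l T); [|exact T_neq0]; rewrite Rmult_0_r.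
  eapply bounded_line_is_constant; intros n; apply K.
- apply Rminus_diag_uniq.
  apply (Rmult_eq_reg_l T); [|exact T_neq0]; rewrite Rmult_0_r.
  eapply bounded_line_is_constant; intros n; apply K.
Qed.

(** The similarity [f] maps the axis to a vertical line, through [(a, b)] say.
    A pair of opposite points at maximal distance from one of the two lines has,
    by the parallelogram identity, a member at least as far from the other line,
    and strictly farther if the lines differ.  Applied on both sides this
    forces [a = b = 0]; then [f] multiplies the distances to the axis by its
    ratio. *)
Lemma similar_radial_range (A B : R3 -> Prop) (m M m' M' : R) :
  0 <= m -> 0 <= M -> 0 <= m' -> 0 <= M' ->
  radial_range A m M -> radial_range B m' M' ->
  half_turn_invariant A -> half_turn_invariant B -> vertically_periodic A ->
  similar A B -> exists s, 0 < s /\ m' = s * m /\ M' = s * M.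
Proof.
intros m_ge0 M_ge0 m'_ge0 M'_ge0 RA RB TA TB PA (s & f & Hf & Hq).
assert (AB : forall p, A p -> B (f p)) by (intros p Ap; apply Hq; now exists p).
assert (s_gt0 : 0 < s) by apply Hf.
destruct (similarity_axis_vertical s f A B m' M' Hf AB) as [W1 W2]; trivial.
{ destruct RA as (_ & (p & Ap & _) & _); now exists p. }
assert (K := fun p => similarity_horizontal s f Hf p
  (Rminus_diag_eq _ _ W1) (Rminus_diag_eq _ _ W2)); clear W1 W2.
set (a := c1 (f (mk3 0 0 0))); set (b := c2 (f (mk3 0 0 0))).
assert (K1 : forall p, (c1 (f p) - a) ^ 2 + (c2 (f p) - b) ^ 2
  = s ^ 2 * axial_dist2 p) by (intros p; apply (K p)).
assert (K2 : forall p, c1 (f (half_turn p)) - a = - (c1 (f p) - a))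
  by (intros p; apply (K p)).
assert (K3 : forall p, c2 (f (half_turn p)) - b = - (c2 (f p) - b))
  by (intros p; apply (K p)).
clear K; clearbody a b.
destruct RA as (RA & (pm & Apm & Epm) & (pM & ApM & EpM)).
destruct RB as (RB & (qm & Bqm & Eqm) & (qM & BqM & EqM)).
assert (s2_gt0 : 0 < s ^ 2) by nra.
assert (H1 : a ^ 2 + b ^ 2 + s ^ 2 * M ^ 2 <= M' ^ 2).
{ rewrite <- EpM, <- K1.
  destruct (RB _ (AB _ ApM)) as [_ B1].
  destruct (RB _ (AB _ (TA _ ApM))) as [_ B2].
  specialize (K2 pM); specialize (K3 pM); unfold axial_dist2 in B1, B2.
  replace (c1 (f (half_turn pM))) with (2 * a - c1 (f pM)) in B2 by lra.
  replace (c2 (f (half_turn pM))) with (2 * b - c2 (f pM)) in B2 by lra.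
  nra. }
assert (H2 : a ^ 2 + b ^ 2 + M' ^ 2 <= s ^ 2 * M ^ 2).
{ destruct (proj1 (Hq _) BqM) as (p & Ap & Ep).
  destruct (proj1 (Hq _) (TB _ BqM)) as (p' & Ap' & Ep').
  pose proof (K1 p) as B1; pose proof (K1 p') as B2.
  rewrite Ep in B1; rewrite Ep' in B2; cbn -[pow] in B2.
  pose proof (Rmult_le_compat_l _ _ _ (Rlt_le _ _ s2_gt0) (proj2 (RA _ Ap))).
  pose proof (Rmult_le_compat_l _ _ _ (Rlt_le _ _ s2_gt0) (proj2 (RA _ Ap'))).
  rewrite <- EqM; unfold axial_dist2 at 1; nra. }
assert (a = 0) by nra; assert (b = 0) by nra; subst a b.
assert (K4 : forall p, axial_dist2 (f p) = s ^ 2 * axial_dist2 p)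
  by (intros p; rewrite <- K1; unfold axial_dist2; ring).
assert (H3 : m' ^ 2 = s ^ 2 * m ^ 2).
{ apply Rle_antisym.
  - rewrite <- Epm, <- K4; apply RB, AB, Apm.
  - destruct (proj1 (Hq _) Bqm) as (p & Ap & Ep).
    rewrite <- Eqm, <- Ep, K4; apply Rmult_le_compat_l; [lra|now apply RA]. }
exists s; split; [exact s_gt0|].
split; apply Rsqr_inj; try apply Rmult_le_pos; try lra; unfold Rsqr; nra.
Qed.

(** * Images of surfaces of revolution *)

Lemma half_turn_invariant_revolution (r h : R -> R) :
  half_turn_invariant (image (revolution r h)).
Proof.
intros p (u & v & ->); exists u, (v + PI).
unfold revolution, half_turn; cbn; rewrite neg_cos, neg_sin.
apply (f_equal3 mk3); ring.
Qed.

Lemma radial_range_revolution (r h : R -> R) (m M : R) :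
  0 <= m -> (forall u, m <= r u <= M) ->
  (exists u, r u = m) -> (exists u, r u = M) ->
  radial_range (image (revolution r h)) m M.
Proof.
intros m_ge0 Hr (um & Em) (uM & EM).
assert (K : forall u v, axial_dist2 (revolution r h u v) = r u ^ 2).
{ intros u v; unfold axial_dist2, revolution; cbn.
  pose proof (sin2_cos2 v) as Hv; unfold Rsqr in Hv.
  transitivity (r u ^ 2 * (sin v * sin v + cos v * cos v)); [ring|].
  rewrite Hv; ring. }
split; [|split].
- intros p (u & v & ->); rewrite K; specialize (Hr u); split; apply pow_incr; lra.
- exists (revolution r h um 0); rewrite K, Em; split; [now exists um, 0|easy].
- exists (revolution r h uM 0); rewrite K, EM; split; [now exists uM, 0|easy].
Qed.

Lemma translational_period_revolution (r h : R -> R) (P T : R) :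
  T <> 0 -> (forall u, r (u + P) = r u) -> (forall u, h (u + P) = h u + T) ->
  has_translational_period (revolution r h).
Proof.
intros T_neq0 Hr Hh; exists T; split; [exact T_neq0|].
intros [[x y] z]; cbn; split; intros (u & v & E); apply pair_equal_spec in E;
  destruct E as [E3 E3']; apply pair_equal_spec in E3; destruct E3 as [E1 E2].
- exists (u + P), v; unfold revolution; rewrite Hr, Hh.
  now apply (f_equal3 mk3); [..|rewrite E3'].
- exists (u - P), v; unfold revolution.
  specialize (Hr (u - P)); specialize (Hh (u - P)).
  replace (u - P + P) with u in Hr, Hh by ring.
  apply (f_equal3 mk3); [now rewrite <- Hr|now rewrite <- Hr|].
  lra.
Qed.

(** * The profile curves *)

Definition ellipse_root (u : R) : R := sqrt (5 - sin u ^ 2).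

(** The part of the third coordinate that does not depend on the member of the
    family; it is an elliptic integral. *)
Definition height (u : R) : R := RInt (fun t => sin t ^ 2 * / ellipse_root t) 0 u.

Definition profile_r (b u : R) : R := ellipse_root u - b * sin u.
Definition profile_h (b u : R) : R := b * cos u - height u.

Definition curvature_radius (b u : R) : R := b + sin u * / ellipse_root u.

(** Any smooth injection of the real line into the interval from 1/2 to 3/2
    would do; this one fits because [PI / 8 < 1 / 2]. *)
Definition family_parameter (l : R) : R := 1 + atan l / 4.

Lemma ellipse_root_bounds (u : R) : 2 <= ellipse_root u <= 3.
Proof.
pose proof (SIN_bound u) as Hu.
unfold ellipse_root; split.
- rewrite <- (sqrt_Rsqr 2) by lra; apply sqrt_le_1_alt; unfold Rsqr; nra.
- rewrite <- (sqrt_Rsqr 3) by lra; apply sqrt_le_1_alt; unfold Rsqr; nra.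
Qed.

Lemma ellipse_root_sq (u : R) : ellipse_root u ^ 2 = 5 - sin u ^ 2.
Proof. pose proof (SIN_bound u); unfold ellipse_root; apply pow2_sqrt; nra. Qed.

Lemma smooth_sin2 : smooth (fun u => sin u ^ 2).
Proof.
destruct smooth_sin_cos as [Hs _].
exact (smooth_mult _ _ Hs (smooth_mult _ _ Hs (smooth_const 1))).
Qed.

Lemma smooth_inv_ellipse_root : smooth (fun u => / ellipse_root u).
Proof.
apply (smooth_inv_sqrt (fun u => 5 - sin u ^ 2)).
- intros u; pose proof (SIN_bound u); nra.
- replace (fun u => 5 - sin u ^ 2) with (fun u => 5 + (-1) * sin u ^ 2)
    by (apply functional_extensionality; intros u; ring).
  apply smooth_plus; [apply smooth_const|].
  apply smooth_mult; [apply smooth_const|apply smooth_sin2].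
Qed.

Lemma smooth_ellipse_root : smooth ellipse_root.
Proof.
replace ellipse_root with (fun u => (5 + (-1) * sin u ^ 2) * / ellipse_root u).
- apply smooth_mult; [|apply smooth_inv_ellipse_root].
  apply smooth_plus; [apply smooth_const|].
  apply smooth_mult; [apply smooth_const|apply smooth_sin2].
- apply functional_extensionality; intros u.
  pose proof (ellipse_root_bounds u).
  replace (5 + -1 * sin u ^ 2) with (ellipse_root u ^ 2) by (rewrite ellipse_root_sq; ring).
  field; lra.
Qed.

Lemma is_derive_ellipse_root (u : R) : is_derive ellipse_root u (- sin u * cos u * / ellipse_root u).
Proof.
pose proof (ellipse_root_bounds u) as H; pose proof (SIN_bound u).
unfold ellipse_root in *; auto_derive; [nra|].
replace (5 + - (sin u * (sin u * 1))) with (5 - sin u ^ 2) by ring.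
field; lra.
Qed.

Lemma smooth_height_integrand : smooth (fun t => sin t ^ 2 * / ellipse_root t).
Proof. apply smooth_mult; [apply smooth_sin2|apply smooth_inv_ellipse_root]. Qed.

Lemma smooth_continuous (f : R -> R) (x : R) : smooth f -> continuous f x.
Proof.
intros Hf; apply (ex_derive_continuous (V := R_NormedModule)), (Hf 1%nat).
Qed.

Lemma ex_RInt_height (x y : R) : ex_RInt (fun t => sin t ^ 2 * / ellipse_root t) x y.
Proof.
apply (ex_RInt_continuous (V := R_CompleteNormedModule)); intros t _.
exact (smooth_continuous _ t smooth_height_integrand).
Qed.

Lemma is_derive_height (u : R) : is_derive height u (sin u ^ 2 * / ellipse_root u).
Proof.
apply (is_derive_RInt (V := R_NormedModule)
  (fun t => sin t ^ 2 * / ellipse_root t) height 0).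
- apply filter_forall; intros x.
  apply (RInt_correct (V := R_CompleteNormedModule)), ex_RInt_height.
- exact (smooth_continuous _ u smooth_height_integrand).
Qed.

Lemma smooth_height : smooth height.
Proof.
exact (smooth_primitive _ _ is_derive_height smooth_height_integrand).
Qed.

Lemma sin_cos_2PI_periodic (u : R) :
  sin (u + 2 * PI) = sin u /\ cos (u + 2 * PI) = cos u.
Proof. rewrite sin_plus, cos_plus, sin_2PI, cos_2PI; split; ring. Qed.

(** The integrand is periodic, so both sides have the same derivative. *)
Lemma height_periodic (u : R) : height (u + 2 * PI) = height u + height (2 * PI).
Proof.
assert (D : forall x, is_derive (fun x => height (x + 2 * PI) - height x) x 0).
{ intros x.
  replace 0 with (1 * (sin (x + 2 * PI) ^ 2 * / ellipse_root (x + 2 * PI))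
    - sin x ^ 2 * / ellipse_root x)
    by (unfold ellipse_root; rewrite (proj1 (sin_cos_2PI_periodic x)); ring).
  apply (is_derive_minus (V := R_NormedModule) (fun x => height (x + 2 * PI))).
  - apply (is_derive_comp (V := R_NormedModule) height); [apply is_derive_height|].
    auto_derive; [easy|ring].
  - apply is_derive_height. }
assert (E : height (u + 2 * PI) - height u = height (0 + 2 * PI) - height 0).
{ destruct (MVT_gen (fun x => height (x + 2 * PI) - height x) 0 u (fun _ => 0))
    as (c & _ & Hc); [intros; apply D| |lra].
  intros x _; apply derivable_continuous_pt, ex_derive_Reals_0.
  eexists; apply D. }
rewrite Rplus_0_l in E.
assert (height 0 = 0) by apply (RInt_point (V := R_CompleteNormedModule)).
lra.
Qed.

(** The root is at most 3 and [(t - sin t cos t) / 2] is a primitive of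
    [(sin t)^2], so the period is at least [PI / 3]. *)
Lemma height_period_gt0 : 0 < height (2 * PI).
Proof.
pose proof PI_RGT_0 as PI_gt0.
assert (I : is_RInt (fun t => sin t ^ 2 / 3) 0 (2 * PI)
  ((2 * PI - sin (2 * PI) * cos (2 * PI)) / 6 - (0 - sin 0 * cos 0) / 6)).
{ apply (is_RInt_derive (V := R_CompleteNormedModule)
    (fun t => (t - sin t * cos t) / 6) (fun t => sin t ^ 2 / 3)); intros t _.
  - auto_derive; [easy|].
    pose proof (sin2_cos2 t) as Ht; unfold Rsqr in Ht.
    replace (cos t * cos t) with (1 - sin t * sin t) by lra.
    nra.
  - apply (smooth_continuous (fun t => sin t ^ 2 * / 3)).
    apply smooth_mult; [apply smooth_sin2|apply smooth_const]. }
apply Rlt_le_trans with (RInt (fun t => sin t ^ 2 / 3) 0 (2 * PI)).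
- rewrite (is_RInt_unique _ _ _ _ I), sin_2PI, sin_0; lra.
- apply RInt_le; [lra|eexists; exact I|apply ex_RInt_height|].
  intros t _; apply Rmult_le_compat_l; [apply pow2_ge_0|].
  apply Rinv_le_contravar; pose proof (ellipse_root_bounds t); lra.
Qed.

Section Profile.

Variable b : R.
Hypothesis b_bounds : 1/2 < b < 3/2.

Lemma sin_inv_ellipse_root_bounds (u : R) : -1/2 <= sin u * / ellipse_root u <= 1/2.
Proof.
pose proof (ellipse_root_bounds u); pose proof (SIN_bound u).
assert (0 < / ellipse_root u) by (apply Rinv_0_lt_compat; lra).
assert (/ ellipse_root u <= / 2) by (apply Rinv_le_contravar; lra).
split; nra.
Qed.

Lemma curvature_radius_bounds (u : R) : b - 1/2 <= curvature_radius b u <= 2.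
Proof. pose proof (sin_inv_ellipse_root_bounds u); unfold curvature_radius; lra. Qed.

Lemma profile_r_bounds (u : R) : 2 - b <= profile_r b u <= 2 + b.
Proof.
pose proof (ellipse_root_bounds u); pose proof (SIN_bound u); pose proof (ellipse_root_sq u).
unfold profile_r; split; [nra|].
(* The bound is attained at [sin u = -1], so the factor [1 + sin u] is split off. *)
assert ((ellipse_root u - 2) * (ellipse_root u + 2) = (1 - sin u) * (1 + sin u)) by nra.
assert (ellipse_root u - 2 <= b * (1 + sin u)) by nra.
lra.
Qed.

Lemma is_derive_profile_r (u : R) :
  is_derive (profile_r b) u (- curvature_radius b u * cos u).
Proof.
replace (- curvature_radius b u * cos u) with (- sin u * cos u * / ellipse_root u - b * cos u)
  by (unfold curvature_radius; ring).
apply (is_derive_minus (V := R_NormedModule)); [apply is_derive_ellipse_root|].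
apply is_derive_scal, is_derive_sin.
Qed.

Lemma is_derive_profile_h (u : R) :
  is_derive (profile_h b) u (- curvature_radius b u * sin u).
Proof.
replace (- curvature_radius b u * sin u) with (b * - sin u - sin u ^ 2 * / ellipse_root u)
  by (unfold curvature_radius; ring).
apply (is_derive_minus (V := R_NormedModule)); [|apply is_derive_height].
apply is_derive_scal, is_derive_cos.
Qed.

Lemma smooth_curvature_radius : smooth (curvature_radius b).
Proof.
apply smooth_plus; [apply smooth_const|].
apply smooth_mult; [apply smooth_sin_cos|apply smooth_inv_ellipse_root].
Qed.

Lemma smooth_profile_r : smooth (profile_r b).
Proof.
replace (profile_r b) with (fun u => ellipse_root u + (- b) * sin u)
  by (apply functional_extensionality; intros u; unfold profile_r; ring).
apply smooth_plus; [apply smooth_ellipse_root|].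
apply smooth_mult; [apply smooth_const|apply smooth_sin_cos].
Qed.

Lemma smooth_profile_h : smooth (profile_h b).
Proof.
replace (profile_h b) with (fun u => b * cos u + (-1) * height u)
  by (apply functional_extensionality; intros u; unfold profile_h; ring).
apply smooth_plus; apply smooth_mult; try apply smooth_const.
- apply smooth_sin_cos.
- apply smooth_height.
Qed.

Let X := revolution (profile_r b) (profile_h b).

Lemma profile_r_gt0 (u : R) : 0 < profile_r b u.
Proof. pose proof (profile_r_bounds u); lra. Qed.

Lemma curvature_radius_gt0 (u : R) : 0 < curvature_radius b u.
Proof. pose proof (curvature_radius_bounds u); lra. Qed.

Lemma immersed_profile : immersed X.
Proof.
apply (immersed_revolution _ _ (curvature_radius b)).
- exact profile_r_gt0.
- exact curvature_radius_gt0.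
- exact is_derive_profile_r.
- exact is_derive_profile_h.
- exact smooth_profile_r.
- exact smooth_profile_h.
Qed.

Lemma complete_profile : complete_surface X.
Proof.
assert (HE := fE_revolution _ _ _ is_derive_profile_r is_derive_profile_h).
assert (HF := fF_revolution _ _ _ is_derive_profile_r is_derive_profile_h).
assert (HG := fG_revolution (profile_r b) (profile_h b)).
assert (C : forall f : R -> R, smooth f ->
  forall u v, continuity_2d_pt (fun u _ => f u ^ 2) u v).
{ intros f Hf u v; apply (continuity_1d_2d_pt_comp (fun x => f x ^ 2));
    [|apply continuity_2d_pt_id1].
  apply derivable_continuous_pt, ex_derive_Reals_0.
  apply (smooth_mult _ _ Hf (smooth_mult _ _ Hf (smooth_const 1)) 1%nat). }
apply (complete_surface_of_bounded_metric X ((b - 1/2) / 2) 4); try lra.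
- intros u v; apply (continuity_2d_pt_ext (fun u _ => curvature_radius b u ^ 2));
    [intros; symmetry; apply HE|apply C, smooth_curvature_radius].
- intros u v; apply (continuity_2d_pt_ext (fun _ _ => 0));
    [intros; symmetry; apply HF|apply continuity_2d_pt_const].
- intros u v; apply (continuity_2d_pt_ext (fun u _ => profile_r b u ^ 2));
    [intros; symmetry; apply HG|apply C, smooth_profile_r].
- intros u v x y; unfold metric_form, X; rewrite HE, HF, HG.
  pose proof (curvature_radius_bounds u); pose proof (profile_r_bounds u).
  assert (((b - 1/2) / 2) ^ 2 <= curvature_radius b u ^ 2) by (apply pow_incr; lra).
  assert (((b - 1/2) / 2) ^ 2 <= profile_r b u ^ 2) by (apply pow_incr; lra).
  pose proof (pow2_ge_0 x); pose proof (pow2_ge_0 y); nra.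
- intros u v x y; unfold metric_form, X; rewrite HE, HF, HG.
  pose proof (curvature_radius_bounds u); pose proof (profile_r_bounds u).
  assert (curvature_radius b u ^ 2 <= 4 ^ 2) by (apply pow_incr; lra).
  assert (profile_r b u ^ 2 <= 4 ^ 2) by (apply pow_incr; lra).
  pose proof (pow2_ge_0 x); pose proof (pow2_ge_0 y); nra.
Qed.

(** Up to the sign of [b], the coefficients are those of the ellipse
    [(r + b sin u)^2 + (sin u)^2 = 5]. *)
Lemma lW_hyperbolic_profile : lW_hyperbolic X.
Proof.
exists (1 + b ^ 2), (- b), 1; split; [|unfold discriminant; nra].
apply (satisfies_lW_revolution _ _ (curvature_radius b) (Derive (curvature_radius b))).
- exact profile_r_gt0.
- exact curvature_radius_gt0.
- exact is_derive_profile_r.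
- exact is_derive_profile_h.
- intros u; apply Derive_correct, (smooth_curvature_radius 1%nat).
- lra.
- intros u; pose proof (ellipse_root_bounds u); unfold profile_r, curvature_radius; field; lra.
Qed.

Lemma translational_period_profile : has_translational_period X.
Proof.
apply (translational_period_revolution _ _ (2 * PI) (- height (2 * PI))).
- pose proof height_period_gt0; lra.
- intros u; unfold profile_r, ellipse_root; now rewrite (proj1 (sin_cos_2PI_periodic u)).
- intros u; unfold profile_h; rewrite (proj2 (sin_cos_2PI_periodic u)), height_periodic; ring.
Qed.

(** The extreme distances occur at the vertical tangents of the profile,
    where [sin u] is 1 or -1 and the root equals 2. *)
Lemma radial_range_profile : radial_range (image X) (2 - b) (2 + b).
Proof.
assert (R2 : sqrt (2 * 2) = 2) by (apply sqrt_square; lra).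
apply radial_range_revolution; [lra|exact profile_r_bounds|..].
- exists (PI / 2); unfold profile_r, ellipse_root; rewrite sin_PI2.
  replace (5 - 1 ^ 2) with (2 * 2) by ring; lra.
- exists (- (PI / 2)); unfold profile_r, ellipse_root; rewrite sin_neg, sin_PI2.
  replace (5 - (- (1)) ^ 2) with (2 * 2) by ring; lra.
Qed.

End Profile.

(** * The family and its members *)

Lemma similar_profiles (b b' : R) :
  1/2 < b < 3/2 -> 1/2 < b' < 3/2 ->
  similar (image (revolution (profile_r b) (profile_h b)))
          (image (revolution (profile_r b') (profile_h b'))) -> b = b'.
Proof.
intros Hb Hb' Hsim.
destruct (translational_period_profile b) as (T & T_neq0 & HT).
assert (E : exists s, 0 < s /\ 2 - b' = s * (2 - b) /\ 2 + b' = s * (2 + b)).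
{ apply (similar_radial_range (image (revolution (profile_r b) (profile_h b)))
    (image (revolution (profile_r b') (profile_h b')))); try lra.
  - now apply radial_range_profile.
  - now apply radial_range_profile.
  - apply half_turn_invariant_revolution.
  - apply half_turn_invariant_revolution.
  - exists T; split; [exact T_neq0|intros p; apply HT].
  - exact Hsim. }
destruct E as (s & _ & Em & EM).
(* The sum of the two equations is [4 = 4 s]. *)
assert (s = 1) by lra; subst s; lra.
Qed.

Lemma family_parameter_bounds (l : R) : 1/2 < family_parameter l < 3/2.
Proof.
pose proof (atan_bound l); pose proof PI_4; unfold family_parameter; lra.
Qed.

Lemma family_parameter_inj (l m : R) :
  family_parameter l = family_parameter m -> l = m.
Proof.
unfold family_parameter; intros E.
destruct (Rtotal_order l m) as [H|[H|H]]; [|exact H|];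
  apply atan_increasing in H; lra.
Qed.

Lemma smooth_family_parameter : smooth family_parameter.
Proof.
assert (H2 : smooth (fun x => 1 + x * x)).
{ apply smooth_plus; [apply smooth_const|].
  apply smooth_mult; apply smooth_id. }
assert (pos : forall x : R, 0 < 1 + x * x) by (intros x; nra).
assert (Hw := smooth_inv_sqrt _ pos H2).
apply (smooth_primitive _
  (fun x => / 4 * (/ sqrt (1 + x * x) * / sqrt (1 + x * x)))).
- intros x; unfold family_parameter.
  rewrite <- Rinv_mult, sqrt_sqrt by (specialize (pos x); lra).
  auto_derive; [easy|].
  field; specialize (pos x); cbn; lra.
- apply smooth_mult; [apply smooth_const|now apply smooth_mult].
Qed.

Theorem corollary3p2 :
  exists r h : R -> R -> R,
    smooth2 r /\ smooth2 h /\
    (forall l : R,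
       immersed (revolution (r l) (h l)) /\
       complete_surface (revolution (r l) (h l)) /\
       lW_hyperbolic (revolution (r l) (h l)) /\
       has_translational_period (revolution (r l) (h l))) /\
    (forall l m : R, l <> m ->
       ~ similar (image (revolution (r l) (h l)))
                 (image (revolution (r m) (h m)))).
Proof.
exists (fun l => profile_r (family_parameter l)),
  (fun l => profile_h (family_parameter l)).
destruct smooth_sin_cos as [Hs Hc].
assert (Hp := smooth_family_parameter).
split; [|split; [|split]].
- replace (fun l => profile_r (family_parameter l)) with
    (fun l u => (fun _ => 1) l * ellipse_root u + (fun l => -1 * family_parameter l) l * sin u).
  + apply (smooth2_plus (fun l u => (fun _ => 1) l * ellipse_root u)
      (fun l u => (fun l => -1 * family_parameter l) l * sin u)).
    * apply (smooth2_separated (fun _ => 1)); [apply smooth_const|apply smooth_ellipse_root].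
    * apply (smooth2_separated (fun l => -1 * family_parameter l)); [|exact Hs].
      now apply smooth_mult; [apply smooth_const|].
  + apply functional_extensionality; intros l.
    apply functional_extensionality; intros u; unfold profile_r; ring.
- replace (fun l => profile_h (family_parameter l)) with
    (fun l u => family_parameter l * cos u + (fun _ => -1) l * height u).
  + apply (smooth2_plus (fun l u => family_parameter l * cos u)
      (fun l u => (fun _ => -1) l * height u)).
    * now apply smooth2_separated.
    * apply (smooth2_separated (fun _ => -1)); [apply smooth_const|apply smooth_height].
  + apply functional_extensionality; intros l.
    apply functional_extensionality; intros u; unfold profile_h; ring.
- intros l; pose proof (family_parameter_bounds l) as Hl.
  split; [|split; [|split]].
  + now apply immersed_profile.
  + now apply complete_profile.
  + now apply lW_hyperbolic_profile.
  + apply translational_period_profile.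
- intros l m l_neq_m Hsim; apply l_neq_m, family_parameter_inj.
  apply similar_profiles; [apply family_parameter_bounds..|exact Hsim].
Qed.
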